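(* Let $A,B$ be strictly positive operators on a Hilbert space $\mathcal{H}$ such that $0<h'I\le A^{-\frac12}BA^{-\frac12}\le hI\le I$ for some positive scalars $h$ and $h'$. Then for each $0\le v\le 1$, $$m_v(h)\,A\sharp_v B\le A\nabla_v B\le M_v(h')\,A\sharp_v B,$$ where $$m_v(x)=1+\frac{2^v v(1-v)(x-1)^2}{(x+1)^{v+1}},\qquad M_v(x)=1+\frac{v(1-v)(x-1)^2}{2x^{v+1}}.$$
   Context: An operator means a bounded linear operator on a Hilbert space $\mathcal{H}$. $X\ge 0$ (positive) means $\langle Xy,y\rangle\ge 0$ for all $y\in\mathcal{H}$; $X$ is strictly positive ($X>0$) if it is positive and invertible; $X\le Y$ means $Y-X\ge 0$; $I$ is the identity operator. For strictly positive $A,B$ and $0\le v\le 1$: $A\sharp_v B=A^{1/2}(A^{-1/2}BA^{-1/2})^vA^{1/2}$ and $A\nabla_v B=(1-v)A+vB$. *)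

(* Defs.v *)
From HB Require Import structures.
From mathcomp Require Import all_boot all_order all_algebra.
From mathcomp Require Import complex.
From mathcomp Require Import all_classical all_reals all_analysis.

Set Implicit Arguments.
Unset Strict Implicit.
Unset Printing Implicit Defensive.

Import Order.TTheory GRing.Theory Num.Theory.
Import numFieldNormedType.Exports.

Local Open Scope classical_set_scope.
Local Open Scope ring_scope.
Local Open Scope complex_scope.

(* Complex Hilbert spaces.  Forms of type [{dot H for Num.conj}] are linear in
   the first argument, conjugate-symmetric and positive definite. *)
Record hilbertType (R : realType) := HilbertType {
  hilbert_sort :> completeNormedModType R[i];
  inner : {dot hilbert_sort for Num.conj};
  inner_normE : forall x : hilbert_sort, inner x x = `|x| ^+ 2 }.

Section Operators.
Variables (R : realType) (H : hilbertType R).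
Implicit Types (A B X Y S : H -> H) (f : R -> R) (p : {poly R}).

Definition bounded_linear X : Prop :=
  linear X /\ exists M : R, forall x, `|X x| <= M%:C * `|x|.

(* In [R[i]], [0 <= z] means that [z] is real and nonnegative. *)
Definition op_positive X : Prop := forall y, 0 <= inner H (X y) y.

Definition op_invertible X : Prop :=
  exists Y, [/\ bounded_linear Y, cancel X Y & cancel Y X].

Definition op_strictly_positive X : Prop := op_positive X /\ op_invertible X.

Definition op_le X Y : Prop := op_positive (Y - X).

(* Operators are added, subtracted and scaled pointwise. *)
Definition rscale (a : R) X : H -> H := a%:C *: X.

Definition op_id : H -> H := idfun.

Definition spectrum X : set R[i] :=
  [set l | ~ op_invertible (X - l *: op_id)].

Definition op_poly p X : H -> H :=
  \sum_(i < size p) rscale p`_i (iter i X).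

Definition op_norm_cvg (S_ : nat -> H -> H) S : Prop :=
  forall e : R, 0 < e ->
    \forall n \near \oo, forall x, `|S_ n x - S x| <= e%:C * `|x|.

(* Continuous functional calculus [f(X)] for self-adjoint [X] (so that the
   spectrum is real) and [f] real-valued and continuous on the spectrum: the
   limit in operator norm of [p_n(X)] for real polynomials [p_n] converging to
   [f] uniformly on the spectrum.  If no such operator exists, [cfc f X] is
   the irrelevant value [0]. *)
Definition is_cfc f X S : Prop :=
  bounded_linear S /\ exists p_ : nat -> {poly R},
    {uniform [set t | spectrum X t%:C], (fun n => horner (p_ n)) @ \oo --> f}
    /\ op_norm_cvg (fun n => op_poly (p_ n) X) S.

Definition cfc f X : H -> H := xget 0 [set S | is_cfc f X S].

Definition op_pow X (s : R) : H -> H := cfc (fun t => t `^ s) X.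

(* [A^(-1/2) B A^(-1/2)] *)
Definition conj_half A B : H -> H :=
  op_pow A (- 2^-1) \o B \o op_pow A (- 2^-1).

Definition op_geom_mean (v : R) A B : H -> H :=
  op_pow A 2^-1 \o op_pow (conj_half A B) v \o op_pow A 2^-1.

Definition op_arith_mean (v : R) A B : H -> H :=
  rscale (1 - v) A + rscale v B.

End Operators.

Arguments op_id {R} H _.

Definition m_coef (R : realType) (v x : R) : R :=
  1 + 2 `^ v * v * (1 - v) * (x - 1) ^+ 2 / (x + 1) `^ (v + 1).

Definition M_coef (R : realType) (v x : R) : R :=
  1 + v * (1 - v) * (x - 1) ^+ 2 / (2 * x `^ (v + 1)).

(* Main.v *)
Require Import Defs.
From HB Require Import structures.
From mathcomp Require Import all_boot all_order all_algebra.
From mathcomp Require Import complex.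
From mathcomp Require Import all_classical all_reals all_analysis.
From mathcomp Require Import ring lra.

Set Implicit Arguments.
Unset Strict Implicit.
Unset Printing Implicit Defensive.

Import Order.TTheory GRing.Theory Num.Theory.
Import numFieldNormedType.Exports.

Local Open Scope ring_scope.
Local Open Scope complex_scope.

(** Conjugating by A^(1/2) turns the two operator inequalities into
    inequalities for C = A^(-1/2) B A^(-1/2): A nabla_v B and A sharp_v B are
    A^(1/2) ((1 - v) I + v C) A^(1/2) and A^(1/2) C^v A^(1/2).  As
    h' <= C <= h <= 1, the functional calculus of C reduces everything to the
    scalar inequalities m_v(h) t^v <= 1 - v + v t <= M_v(h') t^v for
    h' <= t <= h ([scalar_means]).

    The scalar inequalities are a Hermite-Hadamard estimate.  The function
    (1 - v + v t) / t^v equals 1 plus the integral from t to 1 of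
    v (1 - v) (1 - s) / s^(v + 1); this integrand is convex, the midpoint rule
    bounds the integral from below by m_v(t) - 1 and the trapezoid rule bounds
    it from above by M_v(t) - 1.  Both bounds are nonincreasing in t on (0, 1].  The two
    rules are proved here by differentiating their error ([ratio_gap]).

    The functional calculus rests on one fact ([spectral_lower_bound]): if a
    real polynomial p is at least e on the spectrum of a bounded symmetric X,
    then p(X) >= e in the sense of quadratic forms.  The infimum l of the
    quadratic form of p(X) is an approximate eigenvalue of p(X); factoring
    p - l over the complex numbers, some factor X - k fails to be bounded
    below, k must be real because X is symmetric, and p(k) = l.  Hence the
    operator norm of p(X) is at most the supremum of |p| on the spectrum, and
    uniform polynomial approximation gives the existence of f(X), its
    symmetry, its order properties and the product rule f(X) g(X) = (f g)(X)
    when f g is a polynomial.  The polynomials approximating a power function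
    come from Bernstein's proof of the Weierstrass theorem
    ([lipschitz_approx]).

    These arguments see only the approximate point spectrum, the set of real t
    such that X - t is not bounded below.  For a <= X <= b it lies in [a, b] by
    the Cauchy-Schwarz inequality.  When a > 0 the calculus applied to 1 / t
    then produces an inverse of X ([form_invertible]), and this in turn shows
    that the whole real spectrum lies in [a, b]. *)

(** * Real inner product *)

Section RealInner.
Variables (R : realType) (H : hilbertType R).
Implicit Types (x y z : H) (a b c : R) (X Y : H -> H).

(** The norm and the inner product of [H] take values in [R[i]]; their real parts
    make [H] a real inner product space, where order arguments are simpler. *)
Definition nrm x : R := complex.Re `|x|.
Definition ip x y : R := complex.Re (inner H x y).

Lemma nrmE x : `|x| = (nrm x)%:C.
Proof.
have : 0 <= `|x| by [].
rewrite /nrm; case: `|x| => u w; rewrite lecE /= => /andP[/eqP -> _].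
by [].
Qed.

Lemma nrm_ge0 x : 0 <= nrm x.
Proof. by rewrite -ler0c -nrmE. Qed.

Lemma ipxx x : ip x x = nrm x ^+ 2.
Proof. by rewrite /ip inner_normE nrmE -rmorphXn. Qed.

Lemma nrm_eq0 x : (nrm x == 0) = (x == 0).
Proof. by rewrite -[x == 0]normr_eq0 nrmE -(inj_eq (@complexI R)) rmorph0. Qed.

Lemma innerC x y : inner H x y = (inner H y x)^*%C.
Proof. by rewrite hermC /= expr0 mul1r. Qed.

Lemma ipC x y : ip x y = ip y x.
Proof. by rewrite /ip innerC; case: (inner H y x). Qed.

Lemma innerDl x y z : inner H (x + y) z = inner H x z + inner H y z.
Proof. exact: linearDl. Qed.
Lemma innerNl x y : inner H (- x) y = - inner H x y.
Proof. exact: linearNl. Qed.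
Lemma innerZl (c : R[i]) x y : inner H (c *: x) y = c * inner H x y.
Proof. exact: linearZl_LR. Qed.
Lemma innerZr (c : R[i]) x y : inner H x (c *: y) = c^*%C * inner H x y.
Proof. by rewrite innerC innerZl rmorphM [in RHS]innerC. Qed.

Lemma ipDl x y z : ip (x + y) z = ip x z + ip y z.
Proof. by rewrite /ip innerDl; case: (inner H x z) => ? ?; case: (inner H y z). Qed.

Lemma ipZl a x y : ip (a%:C *: x) y = a * ip x y.
Proof. by rewrite /ip innerZl; case: (inner H x y) => ? ? /=; rewrite mul0r subr0. Qed.

Lemma ipNl x y : ip (- x) y = - ip x y.
Proof. by rewrite /ip innerNl; case: (inner H x y). Qed.

Lemma ipBl x y z : ip (x - y) z = ip x z - ip y z.
Proof. by rewrite ipDl ipNl. Qed.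

Lemma ipDr x y z : ip z (x + y) = ip z x + ip z y.
Proof. by rewrite ![ip z _]ipC ipDl. Qed.
Lemma ipZr a x y : ip y (a%:C *: x) = a * ip y x.
Proof. by rewrite ![ip y _]ipC ipZl. Qed.
Lemma ipNr x y : ip y (- x) = - ip y x.
Proof. by rewrite ![ip y _]ipC ipNl. Qed.
Lemma ip0l y : ip 0 y = 0.
Proof. by rewrite /ip linear0l. Qed.

Definition ipE := (ipDl, ipDr, ipNl, ipNr, ipZl, ipZr).

Lemma ipii x y : ip ('i%C *: x) ('i%C *: y) = ip x y.
Proof.
rewrite /ip innerZr innerZl /=.
by case: (inner H x y) => u w /=; ring.
Qed.

Lemma Im_inner x y : complex.Im (inner H x y) = ip x ('i%C *: y).
Proof. by rewrite /ip innerZr; case: (inner H x y) => u w /=; ring. Qed.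

Lemma scaleii x : 'i%C *: ('i%C *: x) = - x.
Proof. by rewrite scalerA -expr2 sqr_i scaleN1r. Qed.

Lemma nrmZ a x : nrm (a%:C *: x) = `|a| * nrm x.
Proof.
apply/(@complexI R); rewrite -nrmE normrZ nrmE rmorphM /=; congr (_ * _).
by rewrite normc_def /= expr0n addr0 sqrtr_sqr.
Qed.

Lemma Re_norm_ge0 (k : R[i]) : 0 <= complex.Re `|k|.
Proof. by have := normr_ge0 k; rewrite lecE => /andP[]. Qed.

Lemma nrmZc (k : R[i]) x : nrm (k *: x) = complex.Re `|k| * nrm x.
Proof. by apply: (@complexI R); rewrite -nrmE normrZ nrmE rmorphM; congr (_ * _). Qed.

Lemma nrmD x y : nrm (x + y) <= nrm x + nrm y.
Proof. by rewrite -lecR rmorphD /= -!nrmE ler_normD. Qed.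

Lemma nrmN x : nrm (- x) = nrm x.
Proof. by rewrite /nrm normrN. Qed.

Lemma nrmBC x y : nrm (x - y) = nrm (y - x).
Proof. by rewrite -nrmN opprB. Qed.

Lemma nrm0 : nrm 0 = 0.
Proof. by apply/eqP; rewrite nrm_eq0. Qed.

Lemma ip_le x y : ip x y <= nrm x * nrm y.
Proof.
have [->|x0] := eqVneq x 0; first by rewrite ip0l nrm0 mul0r.
have [->|y0] := eqVneq y 0; first by rewrite ipC ip0l nrm0 mulr0.
have nx : 0 < nrm x by rewrite lt_neqAle nrm_ge0 eq_sym nrm_eq0 x0.
have ny : 0 < nrm y by rewrite lt_neqAle nrm_ge0 eq_sym nrm_eq0 y0.
have := ipxx ((nrm y)%:C *: x - (nrm x)%:C *: y).
rewrite !ipE !ipxx [ip y x]ipC => e.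
have := sqr_ge0 (nrm ((nrm y)%:C *: x - (nrm x)%:C *: y)); rewrite -{}e.
set a := nrm x in nx *; set b := nrm y in ny *; set c := ip x y => e.
have : 0 <= (a * b) * (a * b - c) by nra.
by rewrite pmulr_rge0 ?mulr_gt0 // subr_ge0.
Qed.

Lemma ip_abs_le x y : `|ip x y| <= nrm x * nrm y.
Proof.
by rewrite ler_norml ip_le andbT lerNl -ipNl (le_trans (ip_le _ _)) // nrmN.
Qed.

End RealInner.

(** * Linear operators and polynomials in an operator *)

Section Operators.
Variables (R : realType) (H : hilbertType R).
Implicit Types (x y z : H) (a b c : R) (X Y : H -> H) (p q : {poly R})
  (P Q : {poly R[i]}).

Definition symmetric_op X := forall x y, ip (X x) y = ip x (X y).

Definition bounded_below X := exists2 c : R, 0 < c & forall x, c * nrm x <= nrm (X x).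

Lemma linear_opD X : linear X -> forall x y, X (x + y) = X x + X y.
Proof. by move=> + x y => /(_ 1 x y); rewrite !scale1r. Qed.

Lemma linear_op0 X : linear X -> X 0 = 0.
Proof. by move=> lX; apply: (addrI (X 0)); rewrite -(linear_opD lX) !addr0. Qed.

Lemma linear_opZ X : linear X -> forall (k : R[i]) x, X (k *: x) = k *: X x.
Proof. by move=> lX k x; have := lX k x 0; rewrite (linear_op0 lX) !addr0. Qed.

Lemma linear_opB X : linear X -> forall x y, X (x - y) = X x - X y.
Proof. by move=> lX x y; rewrite -scaleN1r (linear_opD lX) (linear_opZ lX) scaleN1r. Qed.

Lemma linear_op_sum X n (f : nat -> H) : linear X ->
  X (\sum_(i < n) f i) = \sum_(i < n) X (f i).
Proof.
move=> lX; elim: n => [|n IHn]; first by rewrite !big_ord0 (linear_op0 lX).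
by rewrite !big_ord_recr /= (linear_opD lX) IHn.
Qed.

Lemma bounded_linearP X : bounded_linear X <->
  linear X /\ exists2 M : R, 0 < M & forall x, nrm (X x) <= M * nrm x.
Proof.
split=> [[lX [M hM]]|[lX [M M0 hM]]]; split => //.
  exists (`|M| + 1); first by rewrite ltr_pwDr.
  move=> x; have := hM x; rewrite !nrmE -rmorphM lecR => /le_trans; apply.
  by rewrite ler_wpM2r ?nrm_ge0 // ler_wpDr // ler_norm.
by exists M => x; rewrite !nrmE -rmorphM lecR.
Qed.

(** Multiplication by ['i] is a real isometry whose adjoint is its opposite, so
    that its product with a symmetric [X] is antisymmetric. *)
Lemma symmetric_ip_i X x : linear X -> symmetric_op X -> ip (X x) ('i%C *: x) = 0.
Proof.
move=> lX sX; have h : ip (X x) ('i%C *: x) = ip x ('i%C *: X x).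
  by rewrite sX (linear_opZ lX).
have : ip x ('i%C *: X x) = - ip (X x) ('i%C *: x).
  by rewrite -ipii scaleii ipNr ipC.
by rewrite -h => /eqP; rewrite -subr_eq0 opprK -mulr2n mulrn_eq0 /= => /eqP.
Qed.

(** A complex quadratic form with real values comes from a symmetric operator:
    polarize the identity [ip (X x) ('i *: x) = 0]. *)
Lemma op_positiveP X : linear X ->
  op_positive X <-> symmetric_op X /\ forall x, 0 <= ip (X x) x.
Proof.
move=> lX; split=> [pX|[sX pX]] ; last first.
  move=> y; have := pX y; have := symmetric_ip_i y lX sX.
  rewrite -Im_inner /ip lecE /= => -> ->; by rewrite eqxx.
have i0 x : ip (X x) ('i%C *: x) = 0.
  by rewrite -Im_inner; apply/ger0_Im/pX.
have ic x z : ip (X x) ('i%C *: z) + ip (X z) ('i%C *: x) = 0.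
  have := i0 (x + z); rewrite (linear_opD lX) scalerDr !ipE !i0.
  by rewrite add0r addr0.
split=> [x y|x]; last by have := pX x; rewrite lecE => /andP[].
have := ic x ('i%C *: y); rewrite scaleii (linear_opZ lX) ipii ipNr.
by move/eqP; rewrite addrC subr_eq0 [X in X == _]ipC => /eqP.
Qed.

(** Complex coefficients are needed to split real polynomials into linear
    factors. *)
Definition op_cpoly (P : {poly R[i]}) X x : H :=
  \sum_(i < size P) P`_i *: iter i X x.

Lemma op_cpolyE P X x n : (size P <= n)%N ->
  op_cpoly P X x = \sum_(i < n) P`_i *: iter i X x.
Proof.
move=> Pn; rewrite /op_cpoly (big_ord_widen n (fun i => P`_i *: iter i X x)) //.
rewrite big_mkcond; apply: eq_bigr => i _; case: ltnP => // Pi.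
by rewrite nth_default // scale0r.
Qed.

Lemma op_cpolyD P Q X x : op_cpoly (P + Q) X x = op_cpoly P X x + op_cpoly Q X x.
Proof.
pose n := maxn (size P) (size Q).
rewrite !(@op_cpolyE _ X x n) ?leq_maxl ?leq_maxr ?size_polyD //.
by rewrite -big_split; apply: eq_bigr => i _ /=; rewrite coefD scalerDl.
Qed.

Lemma op_cpolyC (k : R[i]) X x : op_cpoly k%:P X x = k *: x.
Proof. by rewrite (@op_cpolyE _ X x 1) ?size_polyC_leq1 // big_ord1 coefC. Qed.

Lemma op_cpolyMX P X x : linear X -> op_cpoly (P * 'X) X x = X (op_cpoly P X x).
Proof.
move=> lX; rewrite (@op_cpolyE _ X x (size P).+1); last first.
  by rewrite (leq_trans (size_polyMleq _ _)) // size_polyX addn2.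
rewrite big_ord_recl coefMX /= scale0r add0r /op_cpoly.
rewrite (linear_op_sum _ (fun i => P`_i *: iter i X x)) //.
by apply: eq_bigr => i _; rewrite /= coefMX /= (linear_opZ lX).
Qed.

Lemma op_cpolyM P Q X x : linear X ->
  op_cpoly (P * Q) X x = op_cpoly P X (op_cpoly Q X x).
Proof.
move=> lX; elim/poly_ind: P => [|P c IHP].
  by rewrite mul0r /op_cpoly size_poly0 !big_ord0.
rewrite mulrDl mulrAC !op_cpolyD !op_cpolyMX // IHP op_cpolyC; congr (_ + _).
have [->|c0] := eqVneq c 0.
  by rewrite mul0r scale0r /op_cpoly size_poly0 big_ord0.
rewrite /op_cpoly mul_polyC size_scale // scaler_sumr.
by apply: eq_bigr => i _; rewrite coefZ scalerA.
Qed.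

Lemma op_polyE p X x : op_poly p X x = op_cpoly (map_poly (real_complex R) p) X x.
Proof.
rewrite /op_poly /op_cpoly size_map_poly fct_sumE.
by apply: eq_bigr => i _; rewrite coef_map.
Qed.

Lemma op_polyD p q X x : op_poly (p + q) X x = op_poly p X x + op_poly q X x.
Proof. by rewrite !op_polyE rmorphD op_cpolyD. Qed.

Lemma op_polyC a X x : op_poly a%:P X x = a%:C *: x.
Proof. by rewrite op_polyE map_polyC op_cpolyC. Qed.

Lemma op_polyX X x : linear X -> op_poly 'X X x = X x.
Proof.
by move=> lX; rewrite op_polyE map_polyX -['X]mul1r op_cpolyMX // op_cpolyC scale1r.
Qed.

Lemma op_polyM p q X x : linear X -> op_poly (p * q) X x = op_poly p X (op_poly q X x).
Proof. by move=> lX; rewrite !op_polyE rmorphM op_cpolyM. Qed.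

Lemma op_polyZ a p X x : linear X -> op_poly (a *: p) X x = a%:C *: op_poly p X x.
Proof. by move=> lX; rewrite -mul_polyC op_polyM // op_polyC. Qed.

Lemma op_polyN p X x : linear X -> op_poly (- p) X x = - op_poly p X x.
Proof. by move=> lX; rewrite -scaleN1r op_polyZ // rmorphN1 scaleN1r. Qed.

Lemma op_polyB p q X x : linear X -> op_poly (p - q) X x = op_poly p X x - op_poly q X x.
Proof. by move=> lX; rewrite op_polyD op_polyN. Qed.

Definition op_simp := (op_polyM, op_polyB, op_polyD, op_polyZ, op_polyC, op_polyX).

(** Horner induction: a property of operators that holds for scalars and is
    stable under [Y |-> X Y + a] holds for all polynomials in [X]. *)
Lemma poly_op_ind (Q : (H -> H) -> Prop) X :
  linear X ->
  (forall a, Q (fun x => a%:C *: x)) ->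
  (forall Y a, Q Y -> Q (fun x => X (Y x) + a%:C *: x)) ->
  forall p, Q (op_poly p X).
Proof.
move=> lX Q0 QS p; elim/poly_ind: p => [|p a IHp].
  have -> : op_poly 0 X = fun x => 0%:C *: x by apply/funext => x; rewrite op_polyC.
  exact: Q0.
rewrite (_ : op_poly _ X = fun x => X (op_poly p X x) + a%:C *: x); first exact: QS.
by apply/funext => x; rewrite mulrC !op_simp.
Qed.

Lemma linear_op_poly p X : linear X -> linear (op_poly p X).
Proof.
move=> lX; apply: poly_op_ind => // [a k x y|Y a lY k x y].
  by rewrite scalerDr !scalerA mulrC.
rewrite lY lX !scalerDr !addrA; congr (_ + _); rewrite -!addrA; congr (_ + _).
by rewrite addrC !scalerA mulrC.
Qed.

Lemma symmetric_op_poly p X : linear X -> symmetric_op X -> symmetric_op (op_poly p X).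
Proof.
move=> lX sX x y.
have [] // : (forall x y, ip (op_poly p X x) y = ip x (op_poly p X y)) /\
  forall x, op_poly p X (X x) = X (op_poly p X x).
apply: (poly_op_ind (Q := fun Y => (forall x y, ip (Y x) y = ip x (Y y)) /\
   forall x, Y (X x) = X (Y x))) => // [a|Y a [sY cY]].
  by split=> [x' y'|x']; rewrite ?ipE ?(linear_opZ lX).
split=> [x' y'|x']; first by rewrite !ipE sX sY cY.
by rewrite cY (linear_opD lX) (linear_opZ lX).
Qed.

Lemma bounded_op_poly p X : bounded_linear X -> bounded_linear (op_poly p X).
Proof.
move=> bX; have /bounded_linearP[lX [M M0 hM]] := bX; apply/bounded_linearP.
split; first exact: linear_op_poly.
pose bounded Y := exists2 M : R, 0 < M & forall x, nrm (Y x) <= M * nrm x.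
apply: (poly_op_ind (Q := bounded)) => // [a|Y a [K K0 hK]].
  exists (`|a| + 1); first by rewrite ltr_pwDr.
  by move=> x; rewrite nrmZ ler_wpM2r ?nrm_ge0 // lerDl.
exists (M * K + `|a|); first by rewrite ltr_pwDl // mulr_gt0.
move=> x; apply: (le_trans (nrmD _ _)); rewrite mulrDl nrmZ lerD2r.
by apply: (le_trans (hM _)); rewrite -mulrA ler_wpM2l // ltW.
Qed.

End Operators.

(** * The approximate point spectrum *)

Section Spectral.
Variables (R : realType) (H : hilbertType R).
Implicit Types (x y z : H) (a b c : R) (X Y : H -> H) (p q : {poly R}).

Definition shift_op X (k : R[i]) x : H := X x - k *: x.

Lemma linear_shift X k : linear X -> linear (shift_op X k).
Proof.
move=> lX a x y; rewrite /shift_op lX scalerDr scalerBr opprD addrACA.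
by rewrite !scalerA mulrC.
Qed.

(** Only the real part of the approximate point spectrum is recorded; for a
    symmetric operator [nonreal_bounded_below] says that nothing is lost. *)
Definition approx_spectrum X : set R :=
  [set t | ~ bounded_below (shift_op X t%:C)]%classic.

(** This is positivity of [Y] at the vector [K x - Y x], combined with the upper
    bound of the form at [Y x]. *)
Lemma positive_norm_le Y (K : R) : linear Y -> symmetric_op Y -> 0 < K ->
  (forall x, 0 <= ip (Y x) x) -> (forall x, ip (Y x) x <= K * nrm x ^+ 2) ->
  forall x, nrm (Y x) ^+ 2 <= K * ip (Y x) x.
Proof.
move=> lY sY K0 Y0 YK x.
have := Y0 (K%:C *: x - Y x); rewrite (linear_opB lY) (linear_opZ lY) !ipE.
rewrite (sY (Y x) x) !ipxx => h; have h2 := YK (Y x).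
have : 0 <= K * (K * ip (Y x) x - nrm (Y x) ^+ 2).
  move: h h2; set u := ip (Y x) x; set w := nrm (Y x) ^+ 2.
  by set e := ip _ _; rewrite mulrBr mulrA; lra.
by rewrite pmulr_rge0 // subr_ge0.
Qed.

Lemma bounded_ip_le X (M : R) : (forall x, nrm (X x) <= M * nrm x) ->
  forall x, `|ip (X x) x| <= M * nrm x ^+ 2.
Proof.
move=> hM x; apply: (le_trans (ip_abs_le _ _)).
by rewrite expr2 mulrA ler_wpM2r ?nrm_ge0.
Qed.

(** Let [l] be the infimum of the quadratic form of [Y] on the unit sphere.  As
    [Y - l] is positive, [positive_norm_le] bounds the square of [|Y x - l x|] by
    a multiple of [ip (Y x - l x) x]; if [Y - l] were bounded below, its form
    would be at least a positive multiple of the squared norm and [l] could be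
    increased. *)
Lemma approx_spectrum_inf Y x0 : bounded_linear Y -> symmetric_op Y -> x0 != 0 ->
  exists2 l : R, approx_spectrum Y l & forall x, l * nrm x ^+ 2 <= ip (Y x) x.
Proof.
move=> bY sY x00; have /bounded_linearP[lY [M M0 hM]] := bY.
have n0 x : x != 0 -> 0 < nrm x ^+ 2.
  by move=> x0'; rewrite exprn_gt0 // lt_neqAle nrm_ge0 eq_sym nrm_eq0 x0'.
pose S : set R := [set m | forall x, m * nrm x ^+ 2 <= ip (Y x) x]%classic.
have SN : S (- M).
  by move=> x; have := bounded_ip_le hM x; rewrite ler_norml mulNr => /andP[].
have ubS : ubound S (ip (Y x0) x0 / nrm x0 ^+ 2).
  by move=> m Sm; rewrite ler_pdivlMr ?n0.
have hS : has_sup S by split; [exists (- M) | exists (ip (Y x0) x0 / nrm x0 ^+ 2)].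
have Ssup : S (sup S).
  move=> x; have [->|xn] := eqVneq x 0.
    by rewrite (linear_op0 lY) ip0l nrm0 expr0n mulr0.
  rewrite -ler_pdivlMr ?n0 //; apply: ge_sup; first by exists (- M).
  by move=> m Sm; rewrite ler_pdivlMr ?n0.
exists (sup S) => // -[c c0 hc].
pose K := M + `|sup S|; have K0 : 0 < K by rewrite ltr_pwDl.
have key x : nrm (shift_op Y (sup S)%:C x) ^+ 2 <= K * ip (shift_op Y (sup S)%:C x) x.
  apply: (positive_norm_le (linear_shift _ lY)) => //.
  - by move=> u w; rewrite /shift_op !ipE sY.
  - by move=> u; rewrite /shift_op !ipE ipxx subr_ge0; exact: Ssup.
  - move=> u; rewrite /shift_op !ipE ipxx.
    have := bounded_ip_le hM u; rewrite ler_norml => /andP[_ h1].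
    rewrite /K mulrDl; apply: lerD => //.
    by rewrite -mulNr ler_wpM2r ?sqr_ge0 // -normrN ler_norm.
suff /(sup_upper_bound hS) : S (sup S + c ^+ 2 / K).
  by rewrite gerDl leNgt divr_gt0 // exprn_gt0.
move=> x; have := key x; rewrite {2}/shift_op !ipE ipxx => h.
have : (c * nrm x) ^+ 2 <= nrm (shift_op Y (sup S)%:C x) ^+ 2.
  by rewrite ler_pXn2r ?nnegrE ?nrm_ge0 // mulr_ge0 ?nrm_ge0 // ltW.
move=> /le_trans/(_ h); rewrite -ler_pdivrMl // exprMn => h3.
by rewrite mulrDl -lerBrDl [c ^+ 2 / K]mulrC -mulrA.
Qed.

(** For [k = a + i b], the vectors [X x - a x] and [i b x] are orthogonal for
    [ip], hence [|X x - k x|] is at least [|b| |x|]. *)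
Lemma nonreal_bounded_below X (k : R[i]) : linear X -> symmetric_op X ->
  complex.Im k != 0 -> bounded_below (shift_op X k).
Proof.
case: k => a b lX sX /= b0; exists `|b|; rewrite ?normr_gt0 // => x.
have -> : shift_op X (a +i* b) x = shift_op X a%:C x - b%:C *: ('i%C *: x).
  rewrite /shift_op -addrA -opprD; congr (_ - _).
  rewrite scalerA -scalerDl; congr (_ *: _).
  by rewrite [LHS]complexE /= [in RHS]mulrC.
rewrite -(@ler_pXn2r _ 2) ?nnegrE ?mulr_ge0 ?nrm_ge0 //.
rewrite -[X in _ <= X]ipxx exprMn -normrX ger0_norm ?sqr_ge0 //.
have : ip (shift_op X a%:C x) ('i%C *: x) = 0.
  apply: (symmetric_ip_i x (linear_shift a%:C lX)).
  by move=> u v; rewrite /shift_op !ipE sX.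
move: (shift_op X a%:C x) => w w0.
have := sqr_ge0 (nrm w); rewrite !ipE ipii [ip ('i%C *: x) w]ipC w0 !ipxx; nra.
Qed.

Lemma op_cpolyXsubC X (k : R[i]) x : linear X ->
  op_cpoly ('X - k%:P) X x = shift_op X k x.
Proof.
move=> lX; rewrite -polyCN op_cpolyD op_cpolyC scaleNr -['X]mul1r op_cpolyMX //.
by rewrite (_ : 1 = 1%:P) // op_cpolyC scale1r.
Qed.

Lemma bounded_below_prod X (s : seq R[i]) : linear X ->
  (forall k, k \in s -> bounded_below (shift_op X k)) ->
  bounded_below (op_cpoly (\prod_(k <- s) ('X - k%:P)) X).
Proof.
move=> lX; elim: s => [|k s IHs] hs.
  exists 1 => // x; rewrite big_nil (_ : 1 = 1%:P) // op_cpolyC scale1r mul1r lexx //.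
have [c c0 hc] : bounded_below (shift_op X k) by apply: hs; rewrite mem_head.
have [|d d0 hd] := IHs; first by move=> j js; apply: hs; rewrite inE js orbT.
exists (c * d); first by rewrite mulr_gt0.
move=> x; rewrite big_cons op_cpolyM // op_cpolyXsubC //.
by apply: le_trans (hc _); rewrite -mulrA ler_pM2l.
Qed.

(** The infimum [l] of the form of [p(X)] is in the approximate spectrum of
    [p(X)].  If all the factors [X - k] of [p(X) - l] were bounded below, so would
    be [p(X) - l]; therefore some root [k] of [p - l] is in the approximate
    spectrum of [X], and [e <= p(k) = l]. *)
Lemma spectral_lower_bound X p (e : R) : bounded_linear X -> symmetric_op X ->
  (forall t, approx_spectrum X t -> e <= p.[t]) ->
  forall x, e * nrm x ^+ 2 <= ip (op_poly p X x) x.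
Proof.
move=> bX sX hp x0; have lX := bX.1.
have [->|x00] := eqVneq x0 0; first by rewrite nrm0 expr0n mulr0 ipC ip0l.
have [l hl lp] :=
  approx_spectrum_inf (bounded_op_poly p bX) (symmetric_op_poly p lX sX) x00.
apply: le_trans (lp x0); rewrite ler_wpM2r ?sqr_ge0 //.
(* For constant [p] there is no factor to look at, and the hypothesis can be
   used only because the approximate spectrum of [X] is not empty. *)
have [q0|qn0] := eqVneq (p - l%:P) 0.
  have [t ht _] := approx_spectrum_inf bX sX x00.
  have := hp t ht; move/eqP: q0; rewrite subr_eq0 => /eqP->.
  by rewrite hornerC.
pose P := map_poly (real_complex R) (p - l%:P).
have [s Ps] := closed_field_poly_normal P.
have P0 : lead_coef P != 0 by rewrite lead_coef_eq0 map_poly_eq0.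
have [t ts ht] : exists2 k, k \in s & ~ bounded_below (shift_op X k).
  apply: contrapT => hs; apply: hl.
  have [|c c0 hc] := @bounded_below_prod X s lX.
    by move=> k ks; apply: contrapT => hk; apply: hs; exists k.
  pose d := complex.Re `|lead_coef P|.
  have d0 : 0 < d by have := P0; rewrite -normr_gt0 ltcE => /andP[].
  exists (d * c); first exact: mulr_gt0.
  move=> x; have -> : shift_op (op_poly p X) l%:C x = op_cpoly P X x.
    by rewrite -op_polyE op_polyB // op_polyC.
  rewrite Ps -mul_polyC op_cpolyM // op_cpolyC nrmZc -mulrA ler_pM2l //; exact: hc.
have tr : complex.Im t = 0.
  by apply/eqP/negPn/negP => /(nonreal_bounded_below lX sX).
have te : t = (complex.Re t)%:C by case: t tr {ts ht} => u w /= ->.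
rewrite te in ts ht; have := hp _ ht.
have : root P (complex.Re t)%:C.
  by rewrite Ps rootZ // root_prod_XsubC.
rewrite /root horner_map fmorph_eq0 hornerD hornerN hornerC subr_eq0.
by move=> /eqP ->.
Qed.

End Spectral.

(** * Bernstein approximation of power functions *)

Section Bernstein.
Variable R : realType.
Implicit Types (x c : R) (g h : nat -> R) (f : R -> R).

(** The Bernstein polynomial of [g]: the expectation of [g k], as a polynomial in
    ['X], where [k] is the number of successes in [n] independent trials with
    success probability ['X].  Conditioning on one trial gives a recursion without
    binomial coefficients. *)
Fixpoint coin_flips n g : {poly R} :=
  if n is m.+1 then 'X * coin_flips m (g \o succn) + (1 - 'X) * coin_flips m g
  else (g 0)%:P.

Lemma coin_flipsS n g x : (coin_flips n.+1 g).[x] =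
  x * (coin_flips n (g \o succn)).[x] + (1 - x) * (coin_flips n g).[x].
Proof. by rewrite /= hornerD !hornerM hornerD hornerN !hornerX hornerC. Qed.

Lemma coin_flips_lin n g h a b x :
  (coin_flips n (fun k => a * g k + b * h k)).[x] =
  a * (coin_flips n g).[x] + b * (coin_flips n h).[x].
Proof.
elim: n g h => [|n IHn] g h; first by rewrite /= !hornerC.
rewrite !coin_flipsS IHn (IHn (g \o succn) (h \o succn)).
by ring.
Qed.

Lemma coin_flips_cst n c x : (coin_flips n (fun=> c)).[x] = c.
Proof.
elim: n => [|n IHn]; first by rewrite /= !hornerC.
by rewrite coin_flipsS /= IHn -mulrDl addrC subrK mul1r.
Qed.

Lemma coin_flips_le n g h x : 0 <= x -> x <= 1 ->
  (forall k, (k <= n)%N -> g k <= h k) ->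
  (coin_flips n g).[x] <= (coin_flips n h).[x].
Proof.
move=> x0 x1; elim: n g h => [|n IHn] g h gh; first by rewrite /= !hornerC gh.
rewrite !coin_flipsS lerD // ler_wpM2l ?subr_ge0 // IHn // => k kn; apply: gh => //.
exact: leqW.
Qed.

Lemma coin_flips_variance n x c :
  (coin_flips n (fun k => (k%:R - c) ^+ 2)).[x] =
  n%:R * (x * (1 - x)) + (n%:R * x - c) ^+ 2.
Proof.
elim: n c => [|n IHn] c; first by rewrite /= hornerC; ring.
rewrite coin_flipsS IHn.
have -> : (fun k => (k%:R - c) ^+ 2) \o succn = fun k => (k%:R - (c - 1)) ^+ 2.
  by apply/funext => k /=; rewrite -natr1; ring.
by rewrite IHn -natr1; ring.
Qed.

(** Chebyshev's argument.  Since [y <= d + y ^+ 2 / d], the error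
    [L * `|k / n - x|] at [k] successes is at most [L d] plus [L / d] times the
    squared deviation of [k / n] from [x], whose expectation is at most [1 / n].
    With [1 / n <= d ^+ 2] the total is at most [2 L d]. *)
Lemma lipschitz_approx01 f (L : R) : 0 <= L ->
  (forall x y, 0 <= x <= 1 -> 0 <= y <= 1 -> `|f x - f y| <= L * `|x - y|) ->
  forall e : R, 0 < e -> exists p : {poly R},
    forall x, 0 <= x <= 1 -> `|p.[x] - f x| <= e.
Proof.
move=> L0 fL e e0; pose d := e / (L + 1) / 2.
have L1 : 0 < L + 1 by rewrite ltr_pwDr.
have d0 : 0 < d by rewrite !divr_gt0.
have [n nd] : exists n : nat, d ^- 2 <= n.+1%:R.
  exists (Num.trunc (d ^- 2)).
  by rewrite ltW // truncnS_gt.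
exists (coin_flips n.+1 (fun k => f (k%:R / n.+1%:R))) => x /andP[x0 x1].
set N : R := n.+1%:R in nd *; have N0 : 0 < N by rewrite ltr0n.
pose w k : R := (L * d) * 1 + (L / (d * N ^+ 2)) * (k%:R - N * x) ^+ 2.
have key k : (k <= n.+1)%N -> `|f (k%:R / N) - f x| <= w k.
  move=> kn; apply: le_trans (fL _ _ _ _) _; rewrite ?x0 ?x1 //.
    by rewrite divr_ge0 ?ler0n //= ler_pdivrMr // mul1r ler_nat.
  rewrite /w; set y := `|_|.
  have -> : (k%:R - N * x) ^+ 2 = N ^+ 2 * y ^+ 2.
    rewrite /y real_normK ?num_real // -exprMn; congr (_ ^+ 2).
    by rewrite mulrBr mulrCA divff ?mulr1 ?gt_eqF.
  have -> : L / (d * N ^+ 2) * (N ^+ 2 * y ^+ 2) = L * (y ^+ 2 / d).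
    by field; rewrite !gt_eqF.
  rewrite mulr1 -mulrDr ler_wpM2l // -subr_ge0.
  have -> : d + y ^+ 2 / d - y = (d ^+ 2 + y ^+ 2 - d * y) / d by field; rewrite gt_eqF.
  apply: divr_ge0; last exact: ltW.
  by have := sqr_ge0 (d - y); have := sqr_ge0 d; have := sqr_ge0 y; nra.
have W : (coin_flips n.+1 w).[x] <= e.
  rewrite /w coin_flips_lin coin_flips_cst coin_flips_variance -/N subrr expr0n /= addr0.
  have h1 : x * (1 - x) <= 1 by nra.
  have h2 : L / (d * N ^+ 2) * (N * (x * (1 - x))) <= L * d.
    have -> : L / (d * N ^+ 2) * (N * (x * (1 - x))) = L * ((d * N)^-1 * (x * (1 - x))).
      by field; rewrite !gt_eqF.
    rewrite ler_wpM2l //; apply: (@le_trans _ _ (d * N)^-1).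
      by rewrite ler_piMr // invr_ge0 mulr_ge0 ?ltW.
    rewrite invfM ler_pdivrMr // -ler_pdivrMl // -invfM -expr2.
    exact: nd.
  apply: (le_trans (lerD (lexx _) h2)).
  rewrite mulr1 -mulr2n -mulrnAr /d -(mulr_natr _ 2) mulfVK ?pnatr_eq0 //.
  by rewrite mulrA ler_pdivrMr // mulrC ler_wpM2l ?ltW // ltrDl.
have fx : (coin_flips n.+1 (fun=> f x)).[x] = f x by rewrite coin_flips_cst.
have B : (coin_flips n.+1 (fun k => 1 * f (k%:R / N) + (-1) * f x)).[x] =
    (coin_flips n.+1 (fun k => f (k%:R / N))).[x] - f x.
  by rewrite coin_flips_lin fx mul1r mulN1r.
rewrite -B ler_norml; apply/andP; split.
  apply: (@le_trans _ _ (coin_flips n.+1 (fun k => (-1) * w k + 0 * w k)).[x]).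
    by rewrite coin_flips_lin mul0r addr0 mulN1r lerN2.
  apply: coin_flips_le => // k kn; have := key k kn.
  by rewrite ler_norml => /andP[+ _]; lra.
apply: le_trans W; apply: coin_flips_le => // k kn; have := key k kn.
by rewrite ler_norml => /andP[_]; lra.
Qed.

Lemma lipschitz_approx f (a b L : R) : a < b -> 0 <= L ->
  (forall x y, a <= x <= b -> a <= y <= b -> `|f x - f y| <= L * `|x - y|) ->
  forall e : R, 0 < e -> exists p : {poly R},
    forall x, a <= x <= b -> `|p.[x] - f x| <= e.
Proof.
move=> ab L0 fL e e0; have ba : 0 < b - a by rewrite subr_gt0.
have [||p hp] :=
  @lipschitz_approx01 (fun u => f (a + (b - a) * u)) (L * (b - a)) _ _ e e0.
- by rewrite mulr_ge0 // ltW.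
- move=> x y /andP[x0 x1] /andP[y0 y1]; apply: le_trans (fL _ _ _ _) _; try nra.
  rewrite opprD addrACA subrr add0r -mulrBr normrM (gtr0_norm ba); lra.
exists (p \Po ((b - a)^-1 *: ('X - a%:P))) => x /andP[xa xb].
have := hp ((b - a)^-1 * (x - a)).
rewrite mulVKf ?gt_eqF // [a + _]addrC subrK horner_comp !hornerE; apply.
apply/andP; split; first by rewrite mulr_ge0 ?invr_ge0 ?(ltW ba) // subr_ge0.
by rewrite ler_pdivrMl // mulr1 lerD2r.
Qed.

(** [t `^ s] is [expR (s * ln t)]: the exponential is Lipschitz on a half-line
    bounded above, and [ln] is Lipschitz on a half-line away from [0]. *)
Lemma powR_lipschitz (a b s : R) : 0 < a ->
  exists2 L : R, 0 <= L & forall x y, a <= x <= b -> a <= y <= b ->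
    `|x `^ s - y `^ s| <= L * `|x - y|.
Proof.
move=> a0; pose K := `|s| * (`|ln a| + `|ln b|).
exists (expR K * (`|s| / a)).
  by rewrite mulr_ge0 ?expR_ge0 // divr_ge0 // ltW.
have exp_le (u v : R) : u <= v -> expR v - expR u <= expR v * (v - u).
  move=> uv; have := expR_ge1Dx (u - v); rewrite -(ler_pM2l (expR_gt0 v)) -expRD.
  by rewrite [v + _]addrC subrK; lra.
have exp_lip (u v : R) : u <= K -> v <= K -> `|expR u - expR v| <= expR K * `|u - v|.
  wlog uv : u v / u <= v => [W|].
    have /orP[uv|vu] := le_total u v => ? ?; first exact: W.
    by rewrite distrC [`|u - v|]distrC; apply: W.
  move=> uK vK; rewrite distrC [`|u - v|]distrC !ger0_norm ?subr_ge0 ?ler_expR //.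
  by apply: (le_trans (exp_le _ _ uv)); rewrite ler_wpM2r ?subr_ge0 // ler_expR.
have ln_lip (x y : R) : a <= x -> a <= y -> `|ln x - ln y| <= a^-1 * `|x - y|.
  wlog xy : x y / x <= y => [W|].
    have /orP[xy|yx] := le_total x y => ? ?; first exact: W.
    by rewrite distrC [`|x - y|]distrC; apply: W.
  move=> ax ay; have x0 := lt_le_trans a0 ax; have y0 := lt_le_trans a0 ay.
  rewrite distrC [`|x - y|]distrC !ger0_norm ?subr_ge0 ?ler_ln ?posrE //.
  rewrite -ln_div ?posrE //; have -> : y / x = 1 + (y - x) / x by field; rewrite gt_eqF.
  have yx : 0 <= (y - x) / x by rewrite divr_ge0 ?subr_ge0 // ltW.
  apply: (le_trans (le_ln1Dx _)); first by rewrite (lt_le_trans _ yx).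
  by rewrite mulrC ler_wpM2r ?subr_ge0 // lef_pV2 ?posrE.
have sK x : a <= x <= b -> s * ln x <= K.
  move=> /andP[ax xb]; have x0 := lt_le_trans a0 ax.
  apply: (le_trans (ler_norm _)); rewrite normrM ler_wpM2l //.
  have h1 : ln a <= ln x by rewrite ler_ln ?posrE.
  have h2 : ln x <= ln b by rewrite ler_ln ?posrE // (lt_le_trans x0).
  rewrite ler_norml; apply/andP; split.
    have := ler_norm (- ln a); rewrite normrN; have := normr_ge0 (ln b); lra.
  have := ler_norm (ln b); have := normr_ge0 (ln a); lra.
move=> x y hx hy; have /andP[ax _] := hx; have /andP[ay _] := hy.
rewrite /powR !gt_eqF ?(lt_le_trans a0) //.
apply: (le_trans (exp_lip _ _ (sK _ hx) (sK _ hy))).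
rewrite -mulrA ler_wpM2l ?expR_ge0 // -mulrBr normrM -mulrA ler_wpM2l //.
exact: ln_lip.
Qed.

Lemma powR_approx (a b s : R) : 0 < a ->
  forall e : R, 0 < e -> exists p : {poly R},
    forall x, a <= x <= b -> `|p.[x] - x `^ s| <= e.
Proof.
move=> a0 e e0.
(* [lipschitz_approx] works on an interval of positive length. *)
pose b' := Num.max b (a + 1).
have ab : a < b' by rewrite /b' lt_max ltrDl ltr01 orbT.
have [L L0 hL] := powR_lipschitz b' s a0.
have [p hp] := lipschitz_approx ab L0 hL e0.
by exists p => x /andP[ax xb]; apply: hp; rewrite ax /= le_max xb.
Qed.

End Bernstein.

(** * Scalar bounds between weighted means *)

Section Scalar.
Variable R : realType.
Implicit Types (x v a : R).

(** [(1 - v + v * x) / x `^ v], the quotient of the two weighted means of 1 and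
    [x], written as a sum of powers. *)
Definition mean_ratio v x : R := (1 - v) * x `^ (- v) + v * x `^ (1 - v).

(** The error (plus 1) of a quadrature rule for the integral of
    [v * (1 - v) * (1 - s) / s `^ (v + 1)] from [x] to 1: the convex factor
    [s `^ (- (v + 1))] is replaced by its value at [a * x + (1 - a)], which is the
    end point [x] for [a = 1] (the trapezoid rule, as the integrand vanishes at 1)
    and the midpoint for [a = 1 / 2]. *)
Definition ratio_gap v a x : R :=
  mean_ratio v x - v * (1 - v) / 2 * (x - 1) ^+ 2 * (a * x + (1 - a)) `^ (- (v + 1)).

Lemma is_derive_ratio_gap v a x : 0 < x -> 0 < a * x + (1 - a) ->
  is_derive x 1 (ratio_gap v a)
    (v * (1 - v) * (x - 1) * (x `^ (- (v + 1)) - (a * x + (1 - a)) `^ (- (v + 1))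
       + (v + 1) * a / 2 * (x - 1) * (a * x + (1 - a)) `^ (- (v + 1) - 1))).
Proof.
move=> x0 m0; rewrite /ratio_gap /mean_ratio.
have dm : is_derive x 1 (fun t => a * t + (1 - a)) a.
  by apply: is_derive_eq; rewrite /GRing.scale /=; ring.
have dq : is_derive x 1 (fun t => (t - 1) ^+ 2) (2 * (x - 1)).
  by apply: is_derive_eq; rewrite /GRing.scale /=; ring.
have dp := is_derive1_powR (- (v + 1)) m0.
have dc := @is_derive1_comp _ (fun t => t `^ (- (v + 1)))
  (fun t => a * t + (1 - a)) x _ _ dp dm.
have d1 := is_derive1_powR (- v) x0.
have d2 := is_derive1_powR (1 - v) x0.
apply: is_derive_eq; rewrite /GRing.scale /=.
have -> : - v - 1 = - (v + 1) by ring.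
have -> : 1 - v - 1 = - v by ring.
have -> : x `^ (- v) = x * x `^ (- (v + 1)).
  rewrite -[X in X * _]powRr1 ?ltW // -powRD ?(gt_eqF x0) ?implybT //.
  by congr (_ `^ _); ring.
by field.
Qed.

Lemma powRN_le (p x y : R) : 0 <= p -> 0 < x -> x <= y -> y `^ (- p) <= x `^ (- p).
Proof.
move=> p0 x0 xy; have y0 := lt_le_trans x0 xy.
rewrite !powRN lef_pV2 ?posrE ?powR_gt0 //.
by apply: ge0_ler_powR => //; rewrite nnegrE ltW.
Qed.

(** The tangent of the convex function [t `^ (- p)] at [m] lies below its graph;
    this is [ln u <= u - 1] at [u = x / m], exponentiated. *)
Lemma powRN_tangent (p m x : R) : 0 <= p -> 0 < m -> 0 < x ->
  m `^ (- p) - p * (x - m) * m `^ (- p - 1) <= x `^ (- p).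
Proof.
move=> p0 m0 x0; have u0 : 0 < x / m by rewrite divr_gt0.
have -> : x `^ (- p) = (x / m) `^ (- p) * m `^ (- p).
  by rewrite -powRM ?ltW // divfK ?gt_eqF.
have -> : m `^ (- p - 1) = m `^ (- p) / m.
  by rewrite powRD ?(gt_eqF m0) ?implybT // powR_inv1 // ltW.
have -> : m `^ (- p) - p * (x - m) * (m `^ (- p) / m) =
    (1 - p * (x / m - 1)) * m `^ (- p).
  by field; rewrite gt_eqF.
rewrite ler_wpM2r ?powR_ge0 // /powR gt_eqF //.
have ln_le : ln (x / m) <= x / m - 1.
  have -> : ln (x / m) = ln (1 + (x / m - 1)) by congr ln; ring.
  by apply: le_ln1Dx; lra.
apply: le_trans (expR_ge1Dx _); rewrite mulNr lerD2l lerN2.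
by rewrite ler_wpM2l.
Qed.

Lemma ratio_gap1 v a : ratio_gap v a 1 = 1.
Proof.
by rewrite /ratio_gap /mean_ratio !powR1 subrr expr0n /=; ring.
Qed.

(** The gap of the midpoint rule is nonincreasing in [x] by [powRN_tangent], that
    of the trapezoid rule is nondecreasing because its derivative is a
    nonnegative multiple of [(x - 1) ^+ 2]; both equal 1 at [x = 1]. *)
Lemma mean_ratio_bounds v x : 0 <= v -> v <= 1 -> 0 < x -> x <= 1 ->
  1 + v * (1 - v) / 2 * (x - 1) ^+ 2 * ((x + 1) / 2) `^ (- (v + 1)) <= mean_ratio v x /\
  mean_ratio v x <= 1 + v * (1 - v) / 2 * (x - 1) ^+ 2 * x `^ (- (v + 1)).
Proof.
move=> v0 v1 x0 x1.
have vv : 0 <= v * (1 - v) by rewrite mulr_ge0 // subr_ge0.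
have p0 : 0 <= v + 1 by rewrite addr_ge0.
have derv (a t : R) : 0 < t -> 0 < a -> a <= 1 ->
    is_derive t 1 (ratio_gap v a)
      (v * (1 - v) * (t - 1) *
      (t `^ (- (v + 1)) - (a * t + (1 - a)) `^ (- (v + 1))
       + (v + 1) * a / 2 * (t - 1) * (a * t + (1 - a)) `^ (- (v + 1) - 1))).
  move=> t0 a0 a1; apply: is_derive_ratio_gap => //.
  by rewrite ltr_pwDl ?mulr_gt0 // subr_ge0.
have cont (a : R) : 0 < a -> a <= 1 ->
    {within `[x, 1], continuous (ratio_gap v a)}%classic.
  move=> a0 a1; apply: derivable_within_continuous => t; rewrite in_itv /= => /andP[xt _].
  by have [] := derv a t (lt_le_trans x0 xt) a0 a1.
split.
  suff : ratio_gap v 2^-1 1 <= ratio_gap v 2^-1 x.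
    rewrite ratio_gap1 {1}/ratio_gap.
    have -> : 2^-1 * x + (1 - 2^-1) = (x + 1) / 2 by field.
    lra.
  have h0 : 0 < 2^-1 :> R by rewrite invr_gt0.
  have h1 : 2^-1 <= 1 :> R by rewrite invf_le1 // ler1n.
  apply: (@ler0_derive1_le_cc _ (ratio_gap v 2^-1) x 1);
    rewrite ?in_itv /= ?lexx ?x1 //; last exact: cont.
  - move=> t; rewrite in_itv /= => /andP[xt _].
    by have [] := derv 2^-1 t (lt_trans x0 xt) h0 h1.
  - move=> t; rewrite in_itv /= => /andP[xt t1]; have t0 := lt_trans x0 xt.
    rewrite derive1E (derive_val (is_derive := derv 2^-1 t t0 h0 h1)).
    rewrite -mulrA mulr_ge0_le0 // mulr_le0_ge0 ?subr_le0 ?(ltW t1) //.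
    set m := 2^-1 * t + (1 - 2^-1).
    have m0 : 0 < m by rewrite /m; lra.
    have := powRN_tangent p0 m0 t0; have := powR_ge0 m (- (v + 1) - 1).
    have -> : t - m = (t - 1) / 2 by rewrite /m; field.
    set y := m `^ _; set z := m `^ _; set w := t `^ _ => y0 hw.
    have : 0 <= (v + 1) * (1 - t) * y by rewrite !mulr_ge0 // subr_ge0 ltW.
    lra.
suff : ratio_gap v 1 x <= ratio_gap v 1 1.
  rewrite ratio_gap1 {1}/ratio_gap mul1r subrr addr0; lra.
apply: (@ger0_derive1_le_cc _ (ratio_gap v 1) x 1); rewrite ?in_itv /= ?lexx ?x1 //.
- move=> t; rewrite in_itv /= => /andP[xt _].
  by have [] := derv 1 t (lt_trans x0 xt) ltr01 (lexx _).
- move=> t; rewrite in_itv /= => /andP[xt t1]; have t0 := lt_trans x0 xt.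
  rewrite derive1E (derive_val (is_derive := derv 1 t t0 ltr01 (lexx _))).
  rewrite mul1r subrr addr0 subrr add0r.
  have -> : forall y, v * (1 - v) * (t - 1) * ((v + 1) * 1 / 2 * (t - 1) * y) =
      v * (1 - v) * ((v + 1) / 2) * ((t - 1) ^+ 2 * y).
    by move=> y; ring.
  by apply: mulr_ge0; apply: mulr_ge0; rewrite ?sqr_ge0 ?powR_ge0 ?divr_ge0 // ?subr_ge0.
- exact: cont.
Qed.

Lemma m_coefE v x : 0 < x ->
  m_coef v x = 1 + v * (1 - v) / 2 * (x - 1) ^+ 2 * ((x + 1) / 2) `^ (- (v + 1)).
Proof.
move=> x0; have x1 : 0 < x + 1 by rewrite addr_gt0.
have e2 : (2^-1 : R) `^ (- (v + 1)) = 2 * 2 `^ v.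
  rewrite -powR_inv1 // -powRrM mulN1r opprK powRD ?pnatr_eq0 ?implybT //.
  by rewrite powRr1 // mulrC.
rewrite powRM ?invr_ge0 ?(ltW x1) // e2 powRN /m_coef.
by field; rewrite gt_eqF // powR_gt0.
Qed.

Lemma M_coefE v x : 0 < x ->
  M_coef v x = 1 + v * (1 - v) / 2 * (x - 1) ^+ 2 * x `^ (- (v + 1)).
Proof.
by move=> x0; rewrite /M_coef powRN; field; rewrite gt_eqF // powR_gt0.
Qed.

Lemma coef_nonincreasing v x y (k l : R) : 0 <= v -> v <= 1 -> x <= y -> y <= 1 ->
  0 <= l -> l <= k ->
  1 + v * (1 - v) / 2 * (y - 1) ^+ 2 * l <= 1 + v * (1 - v) / 2 * (x - 1) ^+ 2 * k.
Proof.
move=> v0 v1 xy y1 l0 lk.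
rewrite lerD2l -[X in X <= _]mulrA -[X in _ <= X]mulrA.
rewrite ler_wpM2l ?divr_ge0 ?mulr_ge0 ?subr_ge0 // ler_pM ?sqr_ge0 // -subr_ge0.
have -> : (x - 1) ^+ 2 - (y - 1) ^+ 2 = (y - x) * (2 - x - y) by ring.
by apply: mulr_ge0; lra.
Qed.

(** On [(0, 1]] both coefficients are nonincreasing, so that the bounds at [t] are implied
    by the constants [m_coef v h] and [M_coef v h'] taken at the ends of the
    interval. *)
Lemma scalar_means v h h' t : 0 <= v -> v <= 1 -> 0 < h' -> h' <= t -> t <= h -> h <= 1 ->
  m_coef v h * t `^ v <= 1 - v + v * t /\ 1 - v + v * t <= M_coef v h' * t `^ v.
Proof.
move=> v0 v1 h'0 ht th h1; have t0 := lt_le_trans h'0 ht.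
have h0 := lt_le_trans t0 th; have t1 := le_trans th h1.
have p0 : 0 <= v + 1 by rewrite addr_ge0.
have -> : 1 - v + v * t = mean_ratio v t * t `^ v.
  rewrite /mean_ratio mulrDl -!mulrA -!powRD ?(gt_eqF t0) ?implybT //.
  by rewrite addNr subrK powRr0 powRr1 ?ltW // mulr1.
have [lo up] := mean_ratio_bounds v0 v1 t0 t1.
split; rewrite ler_wpM2r ?powR_ge0 //.
  apply: le_trans lo; rewrite m_coefE //; apply: coef_nonincreasing; rewrite ?powR_ge0 //.
  apply: powRN_le => //; lra.
apply: (le_trans up); rewrite M_coefE //; apply: coef_nonincreasing; rewrite ?powR_ge0 //.
exact: powRN_le.
Qed.

End Scalar.

(** * Functional calculus by polynomial limits *)

Section Calculus.
Variables (R : realType) (H : hilbertType R).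
Implicit Types (x y z : H) (a b c : R) (X Y S T : H -> H) (p q : {poly R}) (A : set R).

Lemma uniform_cvgP A (F : nat -> R -> R) (f : R -> R) :
  {uniform A, F @ \oo --> f}%classic <->
  forall e : R, 0 < e ->
    (\forall n \near \oo%classic, forall t, A t -> `|F n t - f t| <= e)%classic.
Proof.
split=> [cF e e0|hF W /uniform_nbhs[E [entE EW]]].
  apply: (cF [set g | forall t, A t -> `|g t - f t| <= e]%classic).
  apply/uniform_nbhs; exists [set xy | ball xy.1 e xy.2]%classic; split.
    exact: (entourage_ball _ (PosNum e0)).
  by move=> g hg t At; rewrite distrC; apply/ltW/hg.
move: entE; rewrite -entourage_from_ballE => -[e /= e0 he].
have e20 : 0 < e / 2 by rewrite divr_gt0.
apply: filterS (hF _ e20) => n hn; apply: EW => t At; apply: he => /=.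
rewrite /ball /= distrC; apply: le_lt_trans (hn t At) _.
by rewrite ltr_pdivrMr // mulr_natr mulr2n ltrDl.
Qed.

Lemma hilbert_complete (u : nat -> H) :
  (forall e : R, 0 < e -> exists N, forall n m, (N <= n)%N -> (N <= m)%N ->
    nrm (u n - u m) <= e) ->
  exists l, forall e : R, 0 < e -> exists N, forall n, (N <= n)%N -> nrm (u n - l) <= e.
Proof.
have realpos (e : R[i]) : 0 < e -> e = (complex.Re e)%:C /\ 0 < complex.Re e.
  by case: e => a b; rewrite ltcE /= => /andP[/eqP -> ->].
move=> cu.
have /cvg_ex[l ul] : (cvg (u n @[n --> \oo]))%classic.
  apply/cauchy_cvgP/cauchy_ballP => e /realpos[ee e0]; near_simpl; rewrite ee.
  have [|N hN] := cu (complex.Re e / 2); first by rewrite divr_gt0.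
  exists ([set n | N <= n]%N, [set n | N <= n]%N)%classic.
    by split; exact: nbhs_infty_ge.
  move=> [n m] [/= Nn Nm]; rewrite -ball_normE /= nrmE ltcR.
  apply: le_lt_trans (hN n m Nn Nm) _.
  by rewrite ltr_pdivrMr // mulr_natr mulr2n ltrDl.
exists l => e e0; have e0C : 0 < e%:C by rewrite ltcR.
have /cvgrPdist_le/(_ _ e0C)[N _ hN] := ul.
by exists N => n Nn; have := hN n Nn; rewrite distrC nrmE lecR.
Qed.

(** Apply [spectral_lower_bound] to the polynomial [e ^+ 2 - p ^+ 2]. *)
Lemma spectral_norm_bound A X p (e : R) : bounded_linear X -> symmetric_op X ->
  (approx_spectrum X `<=` A)%classic -> 0 <= e ->
  (forall t, A t -> `|p.[t]| <= e) -> forall x, nrm (op_poly p X x) <= e * nrm x.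
Proof.
move=> bX sX sA e0 hp x; have lX := bX.1.
rewrite -(@ler_pXn2r _ 2) ?nnegrE ?mulr_ge0 ?nrm_ge0 // -[X in X <= _]ipxx exprMn.
have := @spectral_lower_bound _ _ X ((e ^+ 2)%:P - p * p) 0 bX sX _ x.
rewrite mul0r !op_simp // !ipE ipxx (symmetric_op_poly p lX sX) subr_ge0; apply.
move=> t /sA /hp; rewrite hornerD hornerN hornerC hornerM subr_ge0 -expr2.
by rewrite ler_norml => /andP[h1 h2]; nra.
Qed.

(** [S] is [f(X)], computed with polynomials that approximate [f] on [A].  Two
    sets matter: the spectrum, as in [is_cfc], and an interval known to contain
    the approximate spectrum, which serves before the spectrum is located. *)
Definition calculus_limit A f X S : Prop := bounded_linear S /\
  forall e : R, 0 < e -> exists p, (forall t, A t -> `|p.[t] - f t| <= e) /\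
    forall x, nrm (op_poly p X x - S x) <= e * nrm x.

Definition real_spectrum X : set R := [set t | spectrum X t%:C]%classic.

Lemma op_norm_cvgP (S_ : nat -> H -> H) S : op_norm_cvg S_ S <->
  forall e : R, 0 < e ->
    (\forall n \near \oo%classic, forall x, nrm (S_ n x - S x) <= e * nrm x)%classic.
Proof.
by split=> h e /h; apply: filterS => n + x => /(_ x); rewrite !nrmE -rmorphM lecR.
Qed.

Lemma is_cfcP f X S : is_cfc f X S <-> calculus_limit (real_spectrum X) f X S.
Proof.
split=> [[bS [p_ [/uniform_cvgP pf /op_norm_cvgP pS]]]|[bS hS]]; split=> //.
  move=> e e0; near (\oo%classic : set_system nat) => n; exists (p_ n); split.
    by move=> t At; move: t At; near: n; exact: pf.
  by move=> x; move: x; near: n; exact: pS.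
have /choice[p_ hp] (n : nat) : exists p,
    (forall t, real_spectrum X t -> `|p.[t] - f t| <= n.+1%:R^-1) /\
    forall x, nrm (op_poly p X x - S x) <= n.+1%:R^-1 * nrm x.
  by apply: hS; rewrite invr_gt0 ltr0n.
exists p_; split.
  apply/uniform_cvgP => e e0.
  apply: filterS (near_infty_natSinv_lt (PosNum e0)) => n ne t At.
  exact: le_trans ((hp n).1 t At) (ltW ne).
apply/op_norm_cvgP => e e0.
apply: filterS (near_infty_natSinv_lt (PosNum e0)) => n ne x.
by apply: le_trans ((hp n).2 x) _; rewrite ler_wpM2r ?nrm_ge0 ?ltW.
Unshelve. all: by end_near. Qed.

Lemma calculus_limit_sub A B f X S : (A `<=` B)%classic ->
  calculus_limit B f X S -> calculus_limit A f X S.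
Proof.
move=> AB [bS hS]; split=> // e /hS[p [hp hpS]]; exists p; split=> // t At.
by apply: hp; apply: AB.
Qed.

Lemma le0_small_multiples (u K : R) : 0 <= K ->
  (forall e : R, 0 < e -> e <= 1 -> u <= e * K) -> u <= 0.
Proof.
move=> K0 h; rewrite leNgt; apply/negP => u0.
have K1 : 0 < K + u + 1 by lra.
have e0 : 0 < u / (K + u + 1) by rewrite divr_gt0.
have := h _ e0; rewrite ler_pdivrMr // => /(_ ltac:(lra)).
rewrite mulrAC ler_pdivlMr // ler_pM2l //; lra.
Qed.

(** Real polynomials in [X] are symmetric, and symmetry passes to norm limits. *)
Lemma calculus_limit_sym A f X S : bounded_linear X -> symmetric_op X ->
  calculus_limit A f X S -> symmetric_op S.
Proof.
move=> bX sX [bS hS] x y; apply/eqP; rewrite -subr_eq0 -normr_le0.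
apply: (@le0_small_multiples _ (2 * (nrm x * nrm y))); first by rewrite !mulr_ge0 ?nrm_ge0.
move=> e /hS[p [_ hp]] _.
have -> : ip (S x) y - ip x (S y) =
    ip x (op_poly p X y - S y) - ip (op_poly p X x - S x) y.
  rewrite !ipE (symmetric_op_poly p bX.1 sX); ring.
apply: le_trans (ler_normB _ _) _.
have h1 := le_trans (ip_abs_le _ _) (ler_wpM2l (nrm_ge0 x) (hp y)).
have h2 := le_trans (ip_abs_le _ _) (ler_wpM2r (nrm_ge0 y) (hp x)).
by apply: le_trans (lerD h1 h2) _; rewrite le_eqVlt; apply/orP; left; apply/eqP; ring.
Qed.

(** If [q] is [e]-close to [f] on [A], then [p + c q] is at least [- |c| e] there;
    [spectral_lower_bound] turns this into a bound on forms, up to an error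
    that vanishes with [e]. *)
Lemma calculus_limit_ge0 A f X S c p : bounded_linear X -> symmetric_op X ->
  (approx_spectrum X `<=` A)%classic -> calculus_limit A f X S ->
  (forall t, A t -> 0 <= p.[t] + c * f t) ->
  forall x, 0 <= ip (op_poly p X x + c%:C *: S x) x.
Proof.
move=> bX sX sA [bS hS] hp x; rewrite -oppr_le0; have lX := bX.1.
apply: (@le0_small_multiples _ (2 * `|c| * nrm x ^+ 2)).
  by rewrite !mulr_ge0 ?nrm_ge0.
move=> e /hS[q [hq hqS]] _.
have h1 : - (`|c| * e) * nrm x ^+ 2 <= ip (op_poly (p + c *: q) X x) x.
  apply: spectral_lower_bound => // t /sA At; rewrite hornerD hornerZ.
  have := hp t At; have : `|c * (q.[t] - f t)| <= `|c| * e.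
    by rewrite normrM ler_wpM2l // hq.
  by rewrite ler_norml => /andP[+ _]; lra.
have h2 : `|ip (op_poly q X x - S x) x| <= e * nrm x ^+ 2.
  by apply: le_trans (ip_abs_le _ _) _; rewrite expr2 mulrA ler_wpM2r ?nrm_ge0.
have h3 : `|c * ip (op_poly q X x - S x) x| <= `|c| * (e * nrm x ^+ 2).
  by rewrite normrM ler_wpM2l.
move: h1 h3; rewrite !op_simp // !ipE ler_norml => h1 /andP[_]; lra.
Qed.

(** Let [p1] and [p2] approximate [f] and [g].  Then [p1 p2 - p] is small on [A],
    so that [p1(X) p2(X)] is norm close to [p(X)] by [spectral_norm_bound], and it
    is also close to [S T] because the norm of [p1(X)] is at most [K + 1]. *)
Lemma calculus_limit_mul A f g X S T p (K : R) : bounded_linear X -> symmetric_op X ->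
  (approx_spectrum X `<=` A)%classic ->
  calculus_limit A f X S -> calculus_limit A g X T ->
  (forall t, A t -> `|f t| <= K) -> (forall t, A t -> `|g t| <= K) ->
  (forall t, A t -> f t * g t = p.[t]) ->
  forall x, S (T x) = op_poly p X x.
Proof.
move=> bX sX sA [bS hS] [bT hT] fK gK fg x; have lX := bX.1.
(* A nonzero vector would give a point of the approximate spectrum, so that the
   space is trivial when this set is empty. *)
have [[t tX]|A0] := pselect (exists t, approx_spectrum X t); last first.
  have [//|x0] := eqVneq (S (T x)) (op_poly p X x).
  have [|t ht _] := @approx_spectrum_inf _ _ X (S (T x) - op_poly p X x) bX sX.
    by rewrite subr_eq0.
  by case: A0; exists t.
have K0 : 0 <= K by apply: le_trans (fK t (sA t tX)).
apply/eqP; rewrite -subr_eq0 -nrm_eq0 eq_le nrm_ge0 andbT.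
apply: (@le0_small_multiples _ (nrm (T x) + (K + 1) * nrm x + (2 * K + 1) * nrm x)).
  by rewrite !addr_ge0 // ?mulr_ge0 ?nrm_ge0 //; lra.
move=> e e0 e1; have [p1 [h1 h1S]] := hS e e0; have [p2 [h2 h2T]] := hT e e0.
have n1 y : nrm (op_poly p1 X y) <= (K + 1) * nrm y.
  apply: (spectral_norm_bound bX sX sA); first lra.
  move=> s As; have := fK s As; have := h1 s As.
  by rewrite !ler_norml => /andP[? ?] /andP[? ?]; apply/andP; split; lra.
have n2 : nrm (op_poly (p1 * p2 - p) X x) <= (e * (2 * K + 1)) * nrm x.
  apply: (spectral_norm_bound bX sX sA); first by rewrite mulr_ge0 ?ltW //; lra.
  move=> s As; rewrite hornerD hornerN hornerM -fg //.
  have -> : p1.[s] * p2.[s] - f s * g s = (p1.[s] - f s) * (p2.[s] - g s) +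
      (p1.[s] - f s) * g s + f s * (p2.[s] - g s) by ring.
  apply: le_trans (ler_normD _ _) _; apply: le_trans (lerD (ler_normD _ _) (lexx _)) _.
  rewrite !normrM.
  have k1 := ler_pM (normr_ge0 _) (normr_ge0 _) (h1 s As) (le_trans (h2 s As) e1).
  have k2 := ler_pM (normr_ge0 _) (normr_ge0 _) (h1 s As) (gK s As).
  have k3 := ler_pM (normr_ge0 _) (normr_ge0 _) (fK s As) (h2 s As).
  by apply: le_trans (lerD (lerD k1 k2) k3) _; lra.
have -> : S (T x) - op_poly p X x = (S (T x) - op_poly p1 X (T x))
    + op_poly p1 X (T x - op_poly p2 X x) + op_poly (p1 * p2 - p) X x.
  rewrite !op_simp // (linear_opB (linear_op_poly p1 lX)).
  by rewrite [X in _ = X + _]addrA subrK addrA subrK.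
apply: le_trans (nrmD _ _) _; apply: le_trans (lerD (nrmD _ _) (lexx _)) _.
rewrite (nrmBC (S _)).
have m1 := h1S (T x).
have m2 : nrm (op_poly p1 X (T x - op_poly p2 X x)) <= (K + 1) * (e * nrm x).
  by apply: le_trans (n1 _) _; rewrite ler_wpM2l //; [lra|rewrite nrmBC].
apply: le_trans (lerD (lerD m1 m2) n2) _.
by rewrite le_eqVlt; apply/orP; left; apply/eqP; ring.
Qed.

(** By [spectral_norm_bound], polynomials that converge uniformly on [A] give a
    Cauchy sequence of operators; its pointwise limit is linear, bounded, and a
    limit in norm. *)
Lemma calculus_limit_exists A f X : bounded_linear X -> symmetric_op X ->
  (approx_spectrum X `<=` A)%classic ->
  (forall e : R, 0 < e -> exists p, forall t, A t -> `|p.[t] - f t| <= e) ->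
  exists S, calculus_limit A f X S.
Proof.
move=> bX sX sA hf; have lX := bX.1.
have /choice[p_ hp] (n : nat) : exists p, forall t, A t -> `|p.[t] - f t| <= n.+1%:R^-1.
  by apply: hf; rewrite invr_gt0 ltr0n.
have small (e : R) : 0 < e -> exists N, forall n, (N <= n)%N -> n.+1%:R^-1 <= e.
  move=> e0; have [N _ hN] := near_infty_natSinv_lt (PosNum e0).
  by exists N => n /hN /ltW.
have cau (e : R) : 0 < e -> exists N, forall n m, (N <= n)%N -> (N <= m)%N ->
    forall x, nrm (op_poly (p_ n) X x - op_poly (p_ m) X x) <= e * nrm x.
  move=> e0; have [|N hN] := small (e / 2); first by rewrite divr_gt0.
  exists N => n m /hN hn /hN hm x; rewrite -op_polyB //.
  apply: (spectral_norm_bound bX sX sA); first exact: ltW.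
  move=> t At; rewrite hornerD hornerN.
  have := le_trans (hp n t At) hn; have := le_trans (hp m t At) hm.
  by rewrite !ler_norml => /andP[? ?] /andP[? ?]; apply/andP; split; lra.
have /choice[S hS] (x : H) : exists l, forall e : R, 0 < e ->
    exists N, forall n, (N <= n)%N -> nrm (op_poly (p_ n) X x - l) <= e.
  apply: hilbert_complete => e e0.
  have x1 : 0 < nrm x + 1 by rewrite ltr_wpDl ?nrm_ge0.
  have [|N hN] := cau (e / (nrm x + 1)); first by rewrite divr_gt0.
  exists N => n m Nn Nm; apply: le_trans (hN n m Nn Nm x) _.
  by rewrite mulrAC ler_pdivrMr // ler_wpM2l ?(ltW e0) // lerDl.
have unif (e : R) : 0 < e -> exists N, forall n, (N <= n)%N ->
    forall x, nrm (op_poly (p_ n) X x - S x) <= e * nrm x.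
  move=> /cau[N hN]; exists N => n Nn x; rewrite -subr_le0.
  apply: (@le0_small_multiples _ 1) => // d d0 _; rewrite mulr1.
  have [M hM] := hS x d d0; pose m := maxn N M.
  have := hN n m Nn (leq_maxl _ _) x; have := hM m (leq_maxr _ _).
  have := nrmD (op_poly (p_ n) X x - op_poly (p_ m) X x) (op_poly (p_ m) X x - S x).
  rewrite addrA subrK; lra.
exists S; split.
  apply/bounded_linearP; split.
    move=> k x y; apply/eqP; rewrite -subr_eq0 -nrm_eq0 eq_le nrm_ge0 andbT.
    apply: (@le0_small_multiples _ (nrm (k *: x + y) + nrm x * complex.Re `|k| + nrm y)).
      by rewrite !addr_ge0 ?mulr_ge0 ?nrm_ge0 ?Re_norm_ge0.
    move=> e e0 _; have [N hN] := unif e e0.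
    pose Y := op_poly (p_ N) X; have lY : linear Y by exact: linear_op_poly.
    have -> : S (k *: x + y) - (k *: S x + S y) =
        - (Y (k *: x + y) - S (k *: x + y)) + k *: (Y x - S x) + (Y y - S y).
      rewrite lY opprB scalerBr -[RHS]addrA [X in _ = _ + X]addrACA -opprD.
      by rewrite addrA subrK.
    apply: le_trans (nrmD _ _) _; apply: le_trans (lerD (nrmD _ _) (lexx _)) _.
    rewrite nrmN nrmZc; have h1 := hN N (leqnn _) (k *: x + y).
    have h2 := ler_wpM2l (Re_norm_ge0 k) (hN N (leqnn _) x).
    apply: le_trans (lerD (lerD h1 h2) (hN N (leqnn _) y)) _.
    by rewrite le_eqVlt; apply/orP; left; apply/eqP; ring.
  have [N hN] := unif 1 ltr01.
  have /bounded_linearP[_ [M M0 hM]] := bounded_op_poly (p_ N) bX.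
  exists (M + 1); first by rewrite ltr_wpDl // ltW.
  move=> x; have := hN N (leqnn _) x; have := hM x.
  have := nrmD (op_poly (p_ N) X x) (- (op_poly (p_ N) X x - S x)).
  by rewrite nrmN opprB addrCA subrr addr0; lra.
move=> e e0; have [N hN] := unif e e0; have [M hM] := small e e0.
exists (p_ (maxn N M)); split=> [t At|x].
  exact: le_trans (hp _ t At) (hM _ (leq_maxr _ _)).
exact: hN (leq_maxl _ _) _.
Qed.

End Calculus.

(** * Powers of strictly positive operators *)

Section Bounds.
Variables (R : realType) (H : hilbertType R).
Implicit Types (x y z : H) (a b c : R) (X Y S T : H -> H) (p q : {poly R}) (A : set R).

Definition form_bounds a b X :=
  forall x, a * nrm x ^+ 2 <= ip (X x) x <= b * nrm x ^+ 2.

Lemma form_bounded_below c Y : 0 < c ->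
  (forall x, c * nrm x ^+ 2 <= ip (Y x) x) -> bounded_below Y.
Proof.
move=> c0 hY; exists c => // x.
have [->|x0] := eqVneq x 0; first by rewrite nrm0 mulr0 nrm_ge0.
have n0 : 0 < nrm x by rewrite lt_neqAle nrm_ge0 eq_sym nrm_eq0 x0.
rewrite -(ler_pM2r n0) -mulrA -expr2; exact: le_trans (hY x) (ip_le _ _).
Qed.

(** Outside [[a, b]] the form of [X - t] or of [t - X] is at least a positive
    multiple of the squared norm, and Cauchy-Schwarz concludes. *)
Lemma approx_spectrum_form a b X : form_bounds a b X ->
  (approx_spectrum X `<=` [set t | a <= t <= b])%classic.
Proof.
move=> hX t tX /=; apply/andP; split; rewrite leNgt; apply/negP => lt; apply: tX.
  apply: (@form_bounded_below (a - t)); first by rewrite subr_gt0.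
  move=> x; have /andP[h _] := hX x; rewrite /shift_op !ipE ipxx; lra.
have [||c c0 hc] := @form_bounded_below (t - b) (fun x => - shift_op X t%:C x).
- by rewrite subr_gt0.
- move=> x; have /andP[_ h] := hX x; rewrite /shift_op !ipE ipxx; lra.
- by exists c => // x; rewrite -[nrm (shift_op _ _ _)]nrmN.
Qed.

Lemma invertible_bounded_below X : op_invertible X -> bounded_below X.
Proof.
move=> [Y [/bounded_linearP[_ [M M0 hM]] XK _]]; exists M^-1; first by rewrite invr_gt0.
by move=> x; rewrite ler_pdivrMl // -{1}[x]XK.
Qed.

Lemma approx_spectrum_sub X : (approx_spectrum X `<=` real_spectrum X)%classic.
Proof. by move=> t tX /= /invertible_bounded_below. Qed.

Lemma powR_bounded a b s : 0 < a -> exists K : R, forall t, a <= t <= b -> `|t `^ s| <= K.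
Proof.
move=> a0; have [L L0 hL] := powR_lipschitz b s a0.
exists (L * (b - a) + a `^ s) => t /andP[ta tb].
have -> : t `^ s = (t `^ s - a `^ s) + a `^ s by rewrite subrK.
apply: le_trans (ler_normD _ _) _; rewrite [X in _ + X]ger0_norm ?powR_ge0 // lerD2r.
apply: le_trans (hL _ _ _ _) _; rewrite ?ta ?lexx ?(le_trans ta tb) //.
by rewrite ler_wpM2l // ger0_norm ?subr_ge0 // lerD2r.
Qed.

(** The inverse is the value of the calculus on [[a, b]] at the function
    [t `^ (-1)]; the product rule needs only that the approximate spectrum is in
    [[a, b]]. *)
Lemma form_invertible a b X : bounded_linear X -> symmetric_op X -> 0 < a ->
  form_bounds a b X -> op_invertible X.
Proof.
move=> bX sX a0 hX; have lX := bX.1; have sub := approx_spectrum_form hX.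
have [S hS] := calculus_limit_exists bX sX sub (powR_approx b (-1) a0).
have hI : calculus_limit [set t | a <= t <= b]%classic id X X.
  split=> // e e0; exists 'X; split=> [t _|x]; first by rewrite hornerX subrr normr0 ltW.
  by rewrite op_polyX // subrr nrm0 mulr_ge0 ?nrm_ge0 // ltW.
have [K1 hK1] := powR_bounded b (-1) a0.
have hK2 t : a <= t <= b -> `|t| <= b.
  by move=> /andP[ta tb]; rewrite ger0_norm // ltW // (lt_le_trans a0).
pose K := Num.max K1 b.
have inv t : a <= t <= b -> t `^ (-1) * t = 1.
  move=> /andP[ta _]; have t0 := lt_le_trans a0 ta.
  by rewrite powR_inv1 ?ltW // mulVf // gt_eqF.
have k1 t : a <= t <= b -> `|t `^ (-1)| <= K by move=> /hK1; rewrite le_max => ->.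
have k2 t : a <= t <= b -> `|t| <= K by move=> /hK2; rewrite le_max => ->; rewrite orbT.
exists S; split; first exact: hS.1.
  move=> x; rewrite (calculus_limit_mul (p := 1%:P) bX sX sub hS hI k1 k2).
    by rewrite op_polyC scale1r.
  by move=> t /inv ->; rewrite hornerC.
move=> x; rewrite (calculus_limit_mul (p := 1%:P) bX sX sub hI hS k2 k1).
  by rewrite op_polyC scale1r.
by move=> t /inv; rewrite mulrC hornerC.
Qed.

Lemma bounded_shift X c : bounded_linear X -> bounded_linear (shift_op X c%:C).
Proof.
move=> /bounded_linearP[lX [M M0 hM]]; apply/bounded_linearP.
split; first exact: linear_shift.
exists (M + `|c|); first by rewrite ltr_wpDr.
by move=> x; rewrite (le_trans (nrmD _ _)) // nrmN nrmZ mulrDl lerD2r.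
Qed.

(** For [t] outside [[a, b]], [form_invertible] applies to [X - t] or [t - X]. *)
Lemma real_spectrum_form a b X : bounded_linear X -> symmetric_op X ->
  form_bounds a b X -> (real_spectrum X `<=` [set t | a <= t <= b])%classic.
Proof.
move=> bX sX hX t tX /=; have bXt := bounded_shift t bX.
have sXt : symmetric_op (shift_op X t%:C) by move=> x y; rewrite /shift_op !ipE sX.
apply/andP; split; rewrite leNgt; apply/negP => lt; apply: tX.
  apply: (@form_invertible (a - t) (b - t) _ bXt sXt); first by rewrite subr_gt0.
  move=> x; rewrite /shift_op !ipE ipxx; have /andP[h1 h2] := hX x.
  by apply/andP; split; lra.
have [||||Y [bY K1 K2]] :=
  @form_invertible (t - b) (t - a) (fun x => - shift_op X t%:C x).
- case: bXt => lXt [M hM]; split; last by exists M => x; rewrite normrN.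
  by move=> k x y; rewrite lXt opprD scalerN.
- by move=> x y; rewrite ipNl ipNr sXt.
- by rewrite subr_gt0.
- move=> x; rewrite /shift_op !ipE ipxx; have /andP[h1 h2] := hX x.
  by apply/andP; split; lra.
exists (fun x => Y (- x)); split.
- case: bY => lY [M hM]; split; last by exists M => x; rewrite -[`|x|]normrN.
  by move=> k x y; rewrite opprD -scalerN lY.
- exact: K1.
- by move=> x; apply: oppr_inj; exact: (K2 (- x)).
Qed.

(** The calculus on [[a, b]] provides an operator with the property defining
    [op_pow X s], which is therefore not the default value of [cfc]. *)
Lemma op_pow_spec a b X s : bounded_linear X -> symmetric_op X -> 0 < a ->
  form_bounds a b X -> calculus_limit (real_spectrum X) (fun t => t `^ s) X (op_pow X s).
Proof.
move=> bX sX a0 hX; apply/is_cfcP; rewrite /op_pow /cfc.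
have [S hS] := calculus_limit_exists bX sX (approx_spectrum_form hX) (powR_approx b s a0).
apply: (xgetPex 0); exists S; apply/is_cfcP.
exact: calculus_limit_sub (real_spectrum_form bX sX hX) hS.
Qed.

Lemma op_pow_mul a b X s r p : bounded_linear X -> symmetric_op X -> 0 < a ->
  form_bounds a b X -> (forall t, 0 < t -> t `^ s * t `^ r = p.[t]) ->
  forall x, op_pow X s (op_pow X r x) = op_poly p X x.
Proof.
move=> bX sX a0 hX hp.
have [Ks hs] := powR_bounded b s a0; have [Kr hr] := powR_bounded b r a0.
have sub := real_spectrum_form bX sX hX.
apply: (calculus_limit_mul (K := Num.max Ks Kr) bX sX (@approx_spectrum_sub X)
  (op_pow_spec s bX sX a0 hX) (op_pow_spec r bX sX a0 hX)) => t /sub ht.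
- by rewrite le_max hs.
- by rewrite le_max hr // orbT.
- by apply: hp; case/andP: ht => ta _; exact: lt_le_trans ta.
Qed.

(** If [|X x| >= c |x|] and [M] bounds the norm of [X], then [positive_norm_le]
    gives [c ^+ 2 |x| ^+ 2 <= M * ip (X x) x]. *)
Lemma strictly_positive_form X : bounded_linear X -> op_strictly_positive X ->
  exists a b, 0 < a /\ form_bounds a b X.
Proof.
move=> bX [pX iX]; have /bounded_linearP[lX [M M0 hM]] := bX.
have /(op_positiveP lX)[sX X0] := pX.
have [c c0 hc] := invertible_bounded_below iX.
have XM x : ip (X x) x <= M * nrm x ^+ 2.
  by have := bounded_ip_le hM x; rewrite ler_norml => /andP[].
exists (c ^+ 2 / M), M; split; first by rewrite divr_gt0 // exprn_gt0.
move=> x; rewrite XM andbT.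
have h := positive_norm_le lX sX M0 X0 XM x.
have h2 : (c * nrm x) ^+ 2 <= nrm (X x) ^+ 2.
  by rewrite ler_pXn2r ?nnegrE ?nrm_ge0 // mulr_ge0 ?nrm_ge0 // ltW.
by rewrite mulrAC ler_pdivrMr // -exprMn [_ * M]mulrC; exact: le_trans h2 h.
Qed.

Lemma op_le_ip X Y x : op_le X Y -> ip (X x) x <= ip (Y x) x.
Proof.
move=> /(_ x); rewrite lecE => /andP[_].
by rewrite -[complex.Re (inner _ _ _)]/(ip (Y x - X x) x) /= ipBl subr_ge0.
Qed.

Lemma op_le_intro X Y : linear X -> linear Y -> symmetric_op X -> symmetric_op Y ->
  (forall x, ip (X x) x <= ip (Y x) x) -> op_le X Y.
Proof.
move=> lX lY sX sY h; apply/op_positiveP.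
  by move=> k x y; rewrite !fctE lX lY scalerBr opprD addrACA.
split=> [x y|x]; rewrite ?fctE !ipE; first by rewrite sX sY.
by rewrite subr_ge0.
Qed.

Lemma linear_rscale c X : linear X -> linear (rscale c X).
Proof. by move=> lX k x y; rewrite /rscale !fctE lX scalerDr !scalerA mulrC. Qed.

Lemma symmetric_rscale c X : symmetric_op X -> symmetric_op (rscale c X).
Proof. by move=> sX x y; rewrite /rscale !fctE !ipE sX. Qed.

End Bounds.

(** * Comparison of the operator means *)

Section Means.
Variables (R : realType) (H : hilbertType R).
Implicit Types (x y : H) (X : H -> H).

Lemma op_pow_halfK a b X x : bounded_linear X -> symmetric_op X -> 0 < a ->
  form_bounds a b X -> op_pow X 2^-1 (op_pow X 2^-1 x) = X x.
Proof.
move=> bX sX a0 hX; rewrite (op_pow_mul (p := 'X) bX sX a0 hX).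
  by rewrite op_polyX //; exact: bX.1.
move=> t t0; rewrite hornerX -powRD ?(gt_eqF t0) ?implybT //.
have -> : 2^-1 + 2^-1 = 1 :> R by field.
by rewrite powRr1 // ltW.
Qed.

Lemma op_powNK a b s X x : bounded_linear X -> symmetric_op X -> 0 < a ->
  form_bounds a b X -> op_pow X s (op_pow X (- s) x) = x.
Proof.
move=> bX sX a0 hX; rewrite (op_pow_mul (p := 1%:P) bX sX a0 hX).
  by rewrite op_polyC scale1r.
by move=> t t0; rewrite hornerC -powRD ?(gt_eqF t0) ?implybT // subrr powRr0.
Qed.

(** The bounds [scalar_means] hold on the spectrum of [C]; both inequalities are
    [calculus_limit_ge0] for [f t = t `^ v] and an affine polynomial. *)
Lemma form_means C h h' v y : bounded_linear C -> symmetric_op C -> 0 < h' ->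
  form_bounds h' h C -> h <= 1 -> 0 <= v -> v <= 1 ->
  m_coef v h * ip (op_pow C v y) y <= (1 - v) * ip y y + v * ip (C y) y /\
  (1 - v) * ip y y + v * ip (C y) y <= M_coef v h' * ip (op_pow C v y) y.
Proof.
move=> bC sC h'0 hC h1 v0 v1; have lC := bC.1.
have limD := op_pow_spec v bC sC h'0 hC.
have subC := real_spectrum_form bC sC hC.
pose p : {poly R} := (1 - v)%:P + v *: 'X.
have -> : (1 - v) * ip y y + v * ip (C y) y = ip (op_poly p C y) y.
  by rewrite /p !op_simp // !ipE.
split; rewrite -subr_ge0.
  have := calculus_limit_ge0 (c := - m_coef v h) (p := p) bC sC
    (@approx_spectrum_sub _ _ C) limD.
  move=> /(_ _ y); rewrite ipDl ipZl mulNr; apply.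
  move=> t /subC/andP[t1 t2]; rewrite mulNr subr_ge0 /p !hornerE.
  exact: (scalar_means v0 v1 h'0 t1 t2 h1).1.
have := calculus_limit_ge0 (c := M_coef v h') (p := - p) bC sC
  (@approx_spectrum_sub _ _ C) limD.
move=> /(_ _ y); rewrite ipDl ipZl op_polyN // ipNl addrC; apply.
move=> t /subC/andP[t1 t2]; rewrite hornerN addrC subr_ge0 /p !hornerE.
exact: (scalar_means v0 v1 h'0 t1 t2 h1).2.
Qed.

End Means.

Unset Implicit Arguments.

Theorem theorem1 (R : realType) (H : hilbertType R) (A B : H -> H) (h h' : R)
  (opA : bounded_linear A) (opB : bounded_linear B)
  (A_gt0 : op_strictly_positive A) (B_gt0 : op_strictly_positive B)
  (h_gt0 : 0 < h) (h'_gt0 : 0 < h')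
  (h'I_gt0 : op_strictly_positive (rscale h' (op_id H)))
  (h'_le : op_le (rscale h' (op_id H)) (conj_half A B))
  (le_h : op_le (conj_half A B) (rscale h (op_id H)))
  (h_le1 : op_le (rscale h (op_id H)) (op_id H))
  (v : R) (v_ge0 : 0 <= v) (v_le1 : v <= 1) :
  op_le (rscale (m_coef v h) (op_geom_mean v A B)) (op_arith_mean v A B)
  /\ op_le (op_arith_mean v A B) (rscale (M_coef v h') (op_geom_mean v A B)).
Proof.
(* The comparison of [h] with 1 is extracted below from a nonzero vector; on the
   zero space every operator is positive. *)
have [[x0 x00]|H0] := pselect (exists x : H, x != 0); last first.
  suff all (X : H -> H) : op_positive X by split; exact: all.
  move=> y; have [->|y0] := eqVneq y 0; last by case: H0; exists y.
  by rewrite linear0r.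
have lA := opA.1; have lB := opB.1.
have /(op_positiveP lA)[sA _] := A_gt0.1; have /(op_positiveP lB)[sB _] := B_gt0.1.
have [a [b [a0 hA]]] := strictly_positive_form opA A_gt0.
pose S := op_pow A 2^-1; pose T := op_pow A (- 2^-1).
have limS : calculus_limit _ _ _ S := op_pow_spec 2^-1 opA sA a0 hA.
have limT : calculus_limit _ _ _ T := op_pow_spec (- 2^-1) opA sA a0 hA.
have sS := calculus_limit_sym opA sA limS; have sT := calculus_limit_sym opA sA limT.
have [bS _] := limS; have [bT _] := limT.
have lS := bS.1; have lT := bT.1.
have SS x : S (S x) = A x := op_pow_halfK x opA sA a0 hA.
have ST x : S (T x) = x := op_powNK 2^-1 x opA sA a0 hA.
have TS x : T (S x) = x.
  by have := op_powNK (- 2^-1) x opA sA a0 hA; rewrite opprK.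
pose C := conj_half A B.
have CE x : C x = T (B (T x)) by [].
have sC : symmetric_op C by move=> x y; rewrite !CE sT sB sT.
have bC : bounded_linear C.
  have /bounded_linearP[_ [M M0 hM]] := bT; have /bounded_linearP[_ [N N0 hN]] := opB.
  apply/bounded_linearP; split; first by move=> k x y; rewrite !CE lT lB lT.
  exists (M * (N * M)) => [|x]; first by rewrite !mulr_gt0.
  rewrite CE (le_trans (hM _)) // -!mulrA ler_wpM2l ?(ltW M0) //.
  by rewrite (le_trans (hN _)) // ler_wpM2l ?(ltW N0).
have lC := bC.1.
have hC : form_bounds h' h C.
  move=> x; have := op_le_ip x h'_le; have := op_le_ip x le_h.
  by rewrite /rscale !fctE !ipE !ipxx => -> ->.
have h1 : h <= 1.
  have n0 : 0 < nrm x0 ^+ 2 by rewrite exprn_gt0 // lt_neqAle nrm_ge0 eq_sym nrm_eq0 x00.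
  have := op_le_ip x0 h_le1; rewrite /rscale !fctE !ipE !ipxx.
  by rewrite -[X in _ <= X]mul1r ler_pM2r.
have limD := op_pow_spec v bC sC h'_gt0 hC.
have sD := calculus_limit_sym bC sC limD.
pose D := op_pow C v; rewrite -/D in limD sD; have lD := limD.1.1.
pose G := op_geom_mean v A B.
have GE x : G x = S (D (S x)) by [].
have lG : linear G by move=> k x y; rewrite !GE lS lD lS.
have sG : symmetric_op G by move=> x y; rewrite !GE sS sD sS.
pose N := op_arith_mean v A B.
have NE x : N x = (1 - v)%:C *: A x + v%:C *: B x by [].
have lN : linear N.
  by move=> k x y; rewrite !NE lA lB !scalerDr !scalerA addrACA ![k * _]mulrC.
have sN : symmetric_op N by move=> x y; rewrite !NE !ipE sA sB.
(* From here on, the forms of both means at [x] are forms of functions of [C] at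
   the vector [S x]. *)
have BE x : B x = S (C (S x)) by rewrite CE ST TS.
have Gip x : ip (G x) x = ip (D (S x)) (S x) by rewrite GE sS.
have Nip x : ip (N x) x = (1 - v) * ip (S x) (S x) + v * ip (C (S x)) (S x).
  by rewrite NE !ipE -SS BE !sS.
have means x := form_means (S x) bC sC h'_gt0 hC h1 v_ge0 v_le1.
split; apply: op_le_intro; rewrite -/G -/N //;
  try exact: linear_rscale; try exact: symmetric_rscale.
  move=> x; rewrite Nip /rscale fctE ipZl Gip; exact: (means x).1.
move=> x; rewrite Nip /rscale fctE ipZl Gip; exact: (means x).2.
Qed.
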